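(* Let $p\le q$ and let $(K_{p,q},\sigma)$ be a signed complete bipartite graph whose negative edges induce an $r$-regular subgraph $H$ of order $2k$ (all other edges positive). Then: (i) the multiplicity of the eigenvalue $0$ of $(K_{p,q},\sigma)$ is at least $p+q-2k-2$; (ii) if the $k$ largest eigenvalues of $H$ are $\mu_1=r\ge\mu_2\ge\cdots\ge\mu_k\ge 0$, then $\pm 2\mu_i$ are eigenvalues of $(K_{p,q},\sigma)$ for $i=2,\dots,k$; moreover, the other four eigenvalues of $(K_{p,q},\sigma)$ are $$\pm\sqrt{\frac{pq+(k-2r)^2-k^2\pm\sqrt{\big(pq+(k-2r)^2-k^2\big)^2-4\Big((k-2r)^2+k(q-k)-\frac{k(q-2r)^2}{q}\Big)\,q(p-k)}}{2}}.$$
   Context: A signed graph $\Gamma=(G,\sigma)$ consists of a simple graph $G$ and a sign function $\sigma:E(G)\to\{-1,1\}$; edges with sign $-1$ are negative. Its adjacency matrix $A(\Gamma)$ has $(i,j)$ entry $\sigma(v_iv_j)$ if $v_iv_j\in E(G)$ and $0$ otherwise; eigenvalues of $\Gamma$ are those of $A(\Gamma)$ with multiplicity. Eigenvalues of the unsigned graph $H$ are those of its ordinary adjacency matrix. ''Negative edges induce $H$'' means $H$ is the subgraph of $K_{p,q}$ formed by the negative edges and their endpoints.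
   Formalization: If p=k and q is k or k+1, fewer than four other eigenvalues exist (e.g. K_{1,1} with a negative edge), so there ''the other four eigenvalues'' is proved only after deleting 2k+2-p-q superfluous zeros from the four displayed values; H is taken nonempty (k≥1). *)

(* Defs.v *)
From HB Require Import structures.
From mathcomp Require Import all_boot all_order all_algebra.

Set Implicit Arguments.
Unset Strict Implicit.
Unset Printing Implicit Defensive.

Import Order.TTheory GRing.Theory Num.Theory.
Local Open Scope ring_scope.

Record sgraph (V : finType) := SGraph {
  adj : rel V;
  adj_sym : symmetric adj;
  adj_irrefl : irreflexive adj }.

(* An edge xy is the unordered pair [set x; y]; [true] encodes the sign -1,
   and the values of [negative] outside the edge set are irrelevant. *)
Record signed_graph (V : finType) := SignedGraph {
  underlying : sgraph V;
  negative : {set V} -> bool }.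

Definition regular (V : finType) (r : nat) (G : sgraph V) : Prop :=
  forall x : V, #|[set y | adj G x y]| = r.

Section Adjacency.
Variables (R : pzRingType) (V : finType).

Definition adj_mx (G : sgraph V) : 'M[R]_#|V| :=
  \matrix_(i, j) (adj G (enum_val i) (enum_val j))%:R.

Definition signed_adj_mx (Gam : signed_graph V) : 'M[R]_#|V| :=
  \matrix_(i, j)
    let x := enum_val i in let y := enum_val j in
    if adj (underlying Gam) x y then (-1) ^+ negative Gam [set x; y] else 0.

End Adjacency.

Section NegativeSubgraph.
Variables (V : finType) (Gam : signed_graph V).

Definition neg_edge : rel V :=
  fun x y => adj (underlying Gam) x y && negative Gam [set x; y].

Definition neg_vertices : {set V} := [set x | [exists y, neg_edge x y]].

Definition neg_adj : rel {x : V | x \in neg_vertices} :=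
  fun x y => neg_edge (val x) (val y).

Fact neg_adj_sym : symmetric neg_adj.
Proof. by move=> x y; rewrite /neg_adj /neg_edge adj_sym setUC. Qed.

Fact neg_adj_irrefl : irreflexive neg_adj.
Proof. by move=> x; rewrite /neg_adj /neg_edge adj_irrefl. Qed.

Definition neg_subgraph : sgraph {x : V | x \in neg_vertices} :=
  SGraph neg_adj_sym neg_adj_irrefl.

End NegativeSubgraph.

Section CompleteBipartite.
Variables p q : nat.

Definition Kpq_adj : rel ('I_p + 'I_q)%type := fun x y =>
  match x, y with
  | inl _, inr _ | inr _, inl _ => true
  | _, _ => false
  end.

Fact Kpq_adj_sym : symmetric Kpq_adj. Proof. by case=> ? []. Qed.

Fact Kpq_adj_irrefl : irreflexive Kpq_adj. Proof. by case. Qed.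

Definition Kpq : sgraph ('I_p + 'I_q)%type :=
  SGraph Kpq_adj_sym Kpq_adj_irrefl.

End CompleteBipartite.

(* [s] lists the eigenvalues of [A], with multiplicity. *)
Definition is_spectrum (F : fieldType) (n : nat) (A : 'M[F]_n) (s : seq F) :=
  char_poly A = \prod_(x <- s) ('X - x%:P).

(* Main.v *)
Require Import Defs.
From mathcomp Require Import all_boot all_order all_algebra.
From mathcomp Require Import ring lra zify.
Set Implicit Arguments.
Unset Strict Implicit.
Unset Printing Implicit Defensive.
Import Order.TTheory GRing.Theory Num.Theory.
Local Open Scope ring_scope.

(* The adjacency matrix is u v^T + v u^T - 2 N, where u, v indicate the two parts
   of K_{p,q} and N is the adjacency matrix of H extended by zero.  By regularity
   N maps u and its restriction a to V(H) to r b, and v and its restriction b to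
   r a, so the rank two update can be inverted explicitly:
     char(A) X^2 (X^2 - 4 r^2) = char(-2 N) (X^4 - S X^2 + 4 r^2 (p - k) (q - k)).
   Up to a power of X, char(-2 N) has the roots -2 mu, mu an eigenvalue of H; since
   H is bipartite these come in opposite pairs, and the pair 2r, -2r cancels. *)

(** * Determinants and characteristic polynomials *)

(** The matrix determinant lemma without inverses: [Y] stands for M^-1 U Z. The block matrix with
    rows (M, U) and (W, 1) is multiplied on the right by two block triangular matrices, each
    clearing one off-diagonal block. *)
Lemma det_update (R : comNzRingType) (n m : nat) (M : 'M[R]_n) (U : 'M_(n, m))
    (W : 'M_(m, n)) (Y : 'M_(n, m)) (Z : 'M_m) :
  M *m Y = U *m Z -> \det (M - U *m W) * \det Z = \det M * \det (Z - W *m Y).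
Proof.
move=> MY; transitivity (\det (block_mx M U W 1%:M) * \det Z).
  congr (_ * _).
  have det1L : \det (block_mx 1%:M 0 (- W) 1%:M : 'M_(n + m)) = 1.
    by rewrite det_lblock !det1 mulr1.
  rewrite -[RHS]mulr1 -[X in _ = _ * X]det1L -det_mulmx mulmx_block.
  by rewrite !mulmx1 !mul1mx !mulmx0 !add0r mulmxN subrr det_ublock det1 mulr1.
have -> : \det Z = \det (block_mx 1%:M (- Y) 0 Z).
  by rewrite det_ublock det1 mul1r.
rewrite -det_mulmx mulmx_block !mulmx0 !mulmx1 !addr0 mul1mx !mulmxN MY addNr.
by rewrite det_lblock addrC.
Qed.

(** Sylvester's identity: [det_update] with scalar matrices X for [M] and [Z], [U] and [Y] equal to
    [A], and [W] equal to [B]. *)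
Lemma char_poly_mulC (R : comNzRingType) (n m : nat) (A : 'M[R]_(n, m))
    (B : 'M_(m, n)) :
  char_poly (A *m B) * 'X^m = char_poly (B *m A) * 'X^n.
Proof.
rewrite /char_poly /char_poly_mx !map_mxM -(det_scalar m) -(det_scalar n).
rewrite [RHS]mulrC; apply: det_update.
by rewrite mul_scalar_mx mul_mx_scalar.
Qed.

Lemma det_mx2 (R : comNzRingType) (A : 'M[R]_(1 + 1)) :
  \det A = ulsubmx A 0 0 * drsubmx A 0 0 - ursubmx A 0 0 * dlsubmx A 0 0.
Proof.
rewrite (expand_det_row _ 0) big_ord_recl big_ord1 /cofactor !det_mx11 !mxE /=.
rewrite expr0 expr1 mul1r mulN1r mulrN.
by congr (A _ _ * A _ _ - A _ _ * A _ _); apply: val_inj.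
Qed.

(** [T] kills [u - a] and [v - b] and swaps [a] and [b] up to the factor [c], so its resolvent on
    [u] and [v] is explicit, with denominator X (X^2 - c^2). *)
Lemma char_poly_rank2_update (R : idomainType) (n : nat) (T : 'M[R]_n)
    (u v a b : 'cV_n) (c k p q : R) :
  T *m u = c *: b -> T *m a = c *: b -> T *m v = c *: a -> T *m b = c *: a ->
  u^T *m u = p%:M -> u^T *m v = 0 -> v^T *m v = q%:M ->
  u^T *m a = k%:M -> u^T *m b = 0 -> v^T *m b = k%:M -> v^T *m a = 0 ->
  char_poly (T + u *m v^T + v *m u^T) * ('X^2 * ('X^2 - (c ^+ 2)%:P)) =
  char_poly T * ('X^4 - (p * q + c ^+ 2 + 2 * c * k)%:P * 'X^2
                 + (c ^+ 2 * (p - k) * (q - k))%:P).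
Proof.
move=> Tu Ta Tv Tb uu uv vv ua ub vb va.
have vu : v^T *m u = 0 by rewrite -[LHS]trmxK trmx_mul trmxK uv trmx0.
pose E : {poly R} := 'X^2 - (c ^+ 2)%:P.
have E0 : E != 0 by rewrite monic_neq0 // monicXnsubC.
pose L m1 m2 (M : 'M[R]_(m1, m2)) : 'M[{poly R}]_(m1, m2) := map_mx polyC M.
(* [Y1] and [Y2] are [('X * E) (char_poly_mx T)^-1] applied to [u] and [v]. *)
pose Y1 : 'cV[{poly R}]_n := E *: L _ _ (u - a) + 'X *: ('X *: L _ _ a + c%:P *: L _ _ b).
pose Y2 : 'cV[{poly R}]_n := E *: L _ _ (v - b) + 'X *: ('X *: L _ _ b + c%:P *: L _ _ a).
have := @det_update _ n (1 + 1) (char_poly_mx T)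
  (row_mx (L _ _ u) (L _ _ v)) (col_mx (L _ _ v^T) (L _ _ u^T))
  (row_mx Y1 Y2) (('X * E)%:M).
rewrite mul_row_col opprD addrA -!map_mxM.
have -> : char_poly_mx T - map_mx polyC (u *m v^T) - map_mx polyC (v *m u^T)
          = char_poly_mx (T + u *m v^T + v *m u^T).
  by rewrite /char_poly_mx !map_mxD !opprD !addrA.
have MY : char_poly_mx T *m row_mx Y1 Y2 =
   row_mx (L _ _ u) (L _ _ v) *m ('X * E)%:M.
  rewrite mul_mx_row mul_mx_scalar scale_row_mx; congr row_mx.
    rewrite /Y1 /char_poly_mx !mulmxDr -!scalemxAr mulmxDr -!scalemxAr.
    rewrite !mulmxBl !mul_scalar_mx -!map_mxM mulmxBr Tu Ta subrr Tb.
    rewrite map_mx0 !map_mxZ /L; apply/matrixP=> i j; rewrite !mxE /E.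
    by rewrite polyCB rmorphXn /=; ring.
  rewrite /Y2 /char_poly_mx !mulmxDr -!scalemxAr mulmxDr -!scalemxAr.
  rewrite !mulmxBl !mul_scalar_mx -!map_mxM mulmxBr Tv Tb subrr Ta.
  rewrite map_mx0 !map_mxZ /L; apply/matrixP=> i j; rewrite !mxE /E.
  by rewrite polyCB rmorphXn /=; ring.
move/(_ MY); rewrite det_scalar -/(char_poly _) -/(char_poly T).
have LM (x y : 'cV[R]_n) z : x^T *m y = z%:M -> L _ _ x^T *m L _ _ y = z%:P%:M.
  by move=> xy; rewrite -map_mxM xy map_scalar_mx.
have LM0 (x y : 'cV[R]_n) : x^T *m y = 0 -> L _ _ x^T *m L _ _ y = 0.
  by move=> xy; rewrite -map_mxM xy map_mx0.
rewrite mul_col_row.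
have LB (x y : 'cV[R]_n) : L _ _ (x - y) = L _ _ x - L _ _ y by exact: map_mxB.
have -> : L _ _ v^T *m Y1 = ('X * c%:P * k%:P)%:M.
  rewrite /Y1 LB !(mulmxDr, mulmxN) -!scalemxAr !(mulmxDr, mulmxN) -!scalemxAr.
  rewrite (LM _ _ _ vb) (LM0 _ _ va) (LM0 _ _ vu) subrr !scaler0 !add0r.
  by rewrite !scale_scalar_mx mulrA.
have -> : L _ _ u^T *m Y2 = ('X * c%:P * k%:P)%:M.
  rewrite /Y2 LB !(mulmxDr, mulmxN) -!scalemxAr !(mulmxDr, mulmxN) -!scalemxAr.
  rewrite (LM _ _ _ ua) (LM0 _ _ ub) (LM0 _ _ uv) subrr !scaler0 !add0r.
  by rewrite !scale_scalar_mx mulrA.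
have -> : L _ _ v^T *m Y2 = (E * (q - k)%:P + 'X^2 * k%:P)%:M.
  rewrite /Y2 LB !(mulmxDr, mulmxN) -!scalemxAr !(mulmxDr, mulmxN) -!scalemxAr.
  rewrite (LM _ _ _ vb) (LM0 _ _ va) (LM _ _ _ vv) !scaler0 !addr0.
  by apply/matrixP=> i j; rewrite !mxE !ord1 /= polyCB; ring.
have -> : L _ _ u^T *m Y1 = (E * (p - k)%:P + 'X^2 * k%:P)%:M.
  rewrite /Y1 LB !(mulmxDr, mulmxN) -!scalemxAr !(mulmxDr, mulmxN) -!scalemxAr.
  rewrite (LM _ _ _ ua) (LM0 _ _ ub) (LM _ _ _ uu) !scaler0 !addr0.
  by apply/matrixP=> i j; rewrite !mxE !ord1 /= polyCB; ring.
rewrite (@scalar_mx_block _ 1 1) opp_block_mx add_block_mx det_mx2.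
rewrite block_mxKul block_mxKdr block_mxKdl block_mxKur !mxE /=.
(* In the 2 x 2 determinant the terms without an explicit factor [E] sum to - k^2 X^2 E, so [E]
   divides it and can be cancelled once. *)
move=> detE; apply: (mulIf E0); rewrite -/E.
transitivity (char_poly (T + u *m v^T + v *m u^T) * ('X * E) ^+ 2).
  by rewrite -mulrA; congr (_ * _); ring.
rewrite [LHS]detE -[RHS]mulrA; congr (_ * _).
by rewrite /E !rmorphD !rmorphM !rmorphB /= rmorph_nat; ring.
Qed.

(** The characteristic polynomial of c A is c^n times that of A at X / c; the n factors c are spread
    over the n linear factors. *)
Lemma char_poly_scale (F : fieldType) (n : nat) (c : F) (A : 'M[F]_n) (s : seq F) :
  c != 0 -> is_spectrum A s -> is_spectrum (c *: A) [seq c * x | x <- s].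
Proof.
move=> c0 sA.
have size_s : size s = n.
  by apply: succn_inj; rewrite -(size_char_poly A) sA size_prod_XsubC.
rewrite /is_spectrum big_map.
have -> : char_poly (c *: A) = (c ^+ n)%:P * (char_poly A \Po (c^-1 *: 'X)).
  rewrite /char_poly -det_map_mx rmorphXn -detZ; congr (\det _).
  apply/matrixP=> i j; rewrite !mxE rmorphB rmorphMn /= comp_polyC comp_polyX.
  by rewrite mulrBr -polyCM mulrnAr -mul_polyC mulrA -polyCM divff // mul1r.
rewrite sA rmorph_prod /= -size_s.
elim: s {size_s sA} => [|x s IHs]; first by rewrite !big_nil mulr1.
rewrite !big_cons -IHs exprS /= polyCM comp_polyB comp_polyX comp_polyC.
rewrite -[_ *: 'X]mul_polyC mulrACA; congr (_ * _).
by rewrite mulrBr mulrA -!polyCM divff // mul1r.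
Qed.

(** * Spectra of bipartite and of regular graphs *)

Lemma sum_enum_val (R : nmodType) (V : finType) (F : V -> R) :
  \sum_(i < #|V|) F (enum_val i) = \sum_x F x.
Proof. by rewrite -(big_enum_val (A := V)); apply: eq_bigl. Qed.

(** Conjugation by the diagonal matrix [D] of the signs of the two sides, its own inverse, turns the
    adjacency matrix into its opposite. *)
Lemma bipartite_spectrum_opp (F : numFieldType) (V : finType) (G : sgraph V)
    (side : V -> bool) (s : seq F) :
  (forall x y, adj G x y -> side x != side y) -> is_spectrum (adj_mx F G) s ->
  perm_eq s [seq - x | x <- s].
Proof.
move=> bip sA; apply: prod_XsubC_eq; rewrite -sA.
have N1 : (-1 : F) != 0 by rewrite oppr_eq0 oner_eq0.
have := char_poly_scale N1 sA; rewrite scaleN1r /is_spectrum (eq_map (@mulN1r F)) => <-.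
pose D : 'M[F]_#|V| := diag_mx (\row_i (-1) ^+ side (enum_val i)).
have DD : D *m D = 1%:M.
  by apply/matrixP=> i j; rewrite mul_diag_mx !mxE mulrnAr -expr2 sqrr_sign.
have -> : - adj_mx F G = D *m (adj_mx F G *m D).
  apply/matrixP=> i j; rewrite mul_diag_mx mul_mx_diag !mxE.
  case: (boolP (adj _ _ _)) => [/bip|_]; last by rewrite mul0r mulr0 oppr0.
  by case: (side _); case: (side _) => //= _; ring.
apply: (@mulIf _ ('X^#|V|)); first by rewrite monic_neq0 ?monicXn.
by rewrite char_poly_mulC -mulmxA DD mulmx1.
Qed.

(** Negating and then reversing keeps a list decreasing, and a decreasing list is determined by its
    multiset. *)
Lemma sorted_opp_rev (R : numDomainType) (s : seq R) :
  sorted >=%R s -> perm_eq s [seq - x | x <- s] -> s = rev [seq - x | x <- s].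
Proof.
move=> s_sorted s_opp.
have ge_anti : antisymmetric (>=%R : rel R).
  by move=> x y; rewrite andbC; apply: le_anti.
apply: (sorted_eq ge_trans ge_anti) => //.
- rewrite rev_sorted sorted_map; apply: sub_sorted s_sorted => x y /= le_yx.
  by rewrite lerN2.
- by rewrite perm_sym perm_rev perm_sym.
Qed.

Lemma regular_adj_mulmx1 (R : pzRingType) (V : finType) (G : sgraph V) (r : nat) :
  regular r G ->
  const_mx 1 *m adj_mx R G = r%:R *: const_mx 1 :> 'rV_#|V|.
Proof.
move=> reg; apply/rowP=> j; rewrite !mxE mulr1 -(reg (enum_val j)).
under eq_bigr do rewrite !mxE mul1r adj_sym.
rewrite (sum_enum_val (fun x => (adj G (enum_val j) x)%:R)) -natr_sum.
by rewrite -big_mkcond sum1dep_card.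
Qed.

(** The eigenvector equation is read at a coordinate of largest absolute value, which bounds each of
    the r neighbouring terms. *)
Lemma regular_eigenvalue_le (R : realFieldType) (V : finType) (G : sgraph V)
    (r : nat) (x : R) :
  regular r G -> eigenvalue (adj_mx R G) x -> x <= r%:R.
Proof.
move=> reg /eigenvalueP [w wA w0].
have /rV0Pn [i0 wi0] := w0.
pose i := [arg max_(i > i0) `|w 0 i|]%O.
have [wi maxi] : 0 < `|w 0 i| /\ forall j, `|w 0 j| <= `|w 0 i|.
  rewrite /i; case: arg_maxP => // j _ maxj; split; last by move=> l; apply: maxj.
  by apply: lt_le_trans (maxj i0 isT); rewrite normr_gt0.
rewrite -(ler_pM2r wi) (le_trans (ler_wpM2r (ltW wi) (ler_norm x))) //.
rewrite -normrM.
have -> : x * w 0 i = \sum_j w 0 j * adj_mx R G j i.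
  by move/rowP/(_ i): wA; rewrite !mxE.
apply: le_trans (ler_norm_sum _ _ _) _.
have /rowP/(_ i) := regular_adj_mulmx1 R reg; rewrite !mxE mulr1 => <-.
rewrite mulr_suml; apply: ler_sum => j _.
rewrite !mxE mul1r normrM normr_nat mulrC.
by apply: ler_wpM2l.
Qed.

(** The all-ones vector, nonzero as [V] is nonempty, has eigenvalue [r], and no eigenvalue exceeds
    it. *)
Lemma regular_spectrum_head (R : realFieldType) (V : finType) (G : sgraph V)
    (r : nat) (s : seq R) :
  (0 < #|V|)%N -> regular r G -> is_spectrum (adj_mx R G) s -> sorted >=%R s ->
  s`_0 = r%:R.
Proof.
move=> V0 reg sA s_sorted.
have mem_s x : (x \in s) = eigenvalue (adj_mx R G) x.
  by rewrite eigenvalue_root_char sA root_prod_XsubC.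
have r_in : r%:R \in s.
  rewrite mem_s; apply/eigenvalueP; exists (const_mx 1).
    exact: regular_adj_mulmx1.
  apply/rV0Pn; exists (Ordinal V0); rewrite mxE; exact: oner_neq0.
case: s s_sorted mem_s r_in {sA} => [|y s] //= s_sorted mem_s r_in.
apply/le_anti/andP; split.
  by apply: regular_eigenvalue_le reg _; rewrite -mem_s mem_head.
move: r_in; rewrite inE => /orP [/eqP -> //|].
by move/(order_path_min ge_trans)/allP: s_sorted; apply.
Qed.

(** * The zero-padded adjacency matrix of the negative edges *)

Section NegativeEdges.
Variables (R : comNzRingType) (V : finType) (Gam : signed_graph V).

Definition neg_mx : 'M[R]_#|V| :=
  \matrix_(i, j) (neg_edge Gam (enum_val i) (enum_val j))%:R.

Lemma signed_adj_mxE :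
  signed_adj_mx R Gam = adj_mx R (underlying Gam) - 2 *: neg_mx.
Proof.
apply/matrixP=> i j; rewrite !mxE /neg_edge /=; case: ifP => //= _.
  by case: negative => /=; ring.
by ring.
Qed.

Lemma neg_edge_vertices x y : neg_edge Gam x y -> x \in neg_vertices Gam.
Proof. by move=> xy; rewrite inE; apply/existsP; exists y. Qed.

Lemma neg_edge_sym : symmetric (neg_edge Gam).
Proof. by move=> x y; rewrite /neg_edge adj_sym setUC. Qed.

Lemma neg_degree r x : regular r (neg_subgraph Gam) ->
  #|[set y | neg_edge Gam x y]| = ((x \in neg_vertices Gam) * r)%N.
Proof.
move=> reg; case: (boolP (x \in _)) => [xW|xW].
  rewrite mul1n -(reg (Sub x xW)) -(card_imset _ val_inj); apply: eq_card => y.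
  apply/idP/imsetP => [|[z]]; rewrite !inE => xy.
    have yW : y \in neg_vertices Gam.
      by rewrite neg_edge_sym in xy; apply: neg_edge_vertices xy.
    by exists (Sub y yW) => //; rewrite inE.
  by move->.
rewrite mul0n; apply/eqP; rewrite cards_eq0; apply/eqP/setP=> y.
by rewrite !inE; apply: contraNF xW => /neg_edge_vertices.
Qed.

(* [B] is the inclusion of the vertices of the negative subgraph, so
   [neg_mx = B *m adj_mx *m B^T] and [B^T *m B = 1]. *)
Lemma char_poly_neg_mx (c : R) :
  char_poly (c *: neg_mx) * 'X^#|neg_vertices Gam| =
  char_poly (c *: adj_mx R (neg_subgraph Gam)) * 'X^#|V|.
Proof.
pose W := {x : V | x \in neg_vertices Gam}.
pose B : 'M[R]_(#|V|, #|{: W}|) :=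
  \matrix_(i, j) (enum_val i == val (enum_val j))%:R.
have BB : B^T *m B = 1%:M.
  apply/matrixP=> i j; rewrite !mxE.
  under eq_bigr do rewrite !mxE.
  rewrite (sum_enum_val (fun x => (x == val (enum_val i))%:R
    * (x == val (enum_val j))%:R)).
  rewrite (bigD1 (val (enum_val i))) //= eqxx mul1r big1 => [|x /negPf ->]; last first.
    by rewrite mul0r.
  by rewrite addr0 (inj_eq val_inj) (inj_eq enum_val_inj).
have NB : neg_mx = B *m (adj_mx R (neg_subgraph Gam) *m B^T).
  apply/matrixP=> i j; rewrite !mxE.
  (* Row [y] of [B] is a unit vector if [y] lies in H and zero otherwise, so it evaluates [F] at
     [y], with default 0. *)
  have step (F : W -> R) y : \sum_(l < #|{: W}|) (y == val (enum_val l))%:R * F (enum_val l)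
     = (if insub y is Some w then F w else 0).
    rewrite (sum_enum_val (fun w => (y == val w)%:R * F w)).
    case: insubP => [w yW wy|yW].
      rewrite (bigD1 w) //= wy eqxx mul1r big1 ?addr0 // => z zw.
      by rewrite -wy (inj_eq val_inj) eq_sym (negPf zw) mul0r.
    rewrite big1 // => z _; case: eqP => [yz|]; last by rewrite mul0r.
    by rewrite yz (valP z) in yW.
  under eq_bigr => l _.
    rewrite !mxE; under eq_bigr do rewrite !mxE mulrC.
    rewrite (step (fun w => (adj (neg_subgraph Gam) (enum_val l) w)%:R)).
    over.
  rewrite (step (fun l => match insub (enum_val j) with Some w =>
     (adj (neg_subgraph Gam) l w)%:R | None => 0 end)).
  case: insubP => [w xW <-|xW].
    case: insubP => [z yW <- //|yW].
    case E: neg_edge => //; rewrite neg_edge_sym in E.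
    by rewrite (neg_edge_vertices E) in yW.
  by case E: neg_edge => //; rewrite (neg_edge_vertices E) in xW.
have <- : #|{: W}| = #|neg_vertices Gam| by rewrite card_sig.
by rewrite NB scalemxAr char_poly_mulC -scalemxAl -mulmxA BB mulmx1.
Qed.

End NegativeEdges.

(** * Indicator vectors, and how the negative edges of K_{p,q} act on them *)

Section IndicatorVectors.
Variables (R : pzRingType) (V : finType).

Definition ind_col (P : pred V) : 'cV[R]_#|V| := \col_i (P (enum_val i))%:R.

Lemma ind_col_dot (P Q : pred V) :
  (ind_col P)^T *m ind_col Q = #|[set x | P x && Q x]|%:R%:M.
Proof.
apply/matrixP=> i j; rewrite !ord1 !mxE /= mulr1n.
under eq_bigr do rewrite !mxE -natrM mulnb.
rewrite (sum_enum_val (fun x => (P x && Q x)%:R)) -natr_sum.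
by rewrite -big_mkcond sum1dep_card.
Qed.

End IndicatorVectors.

Section NegativeEdgesOfKpq.
Variables (p q r k : nat) (sigma : {set ('I_p + 'I_q)%type} -> bool).

Local Notation V := ('I_p + 'I_q)%type.
Local Notation Gam := (SignedGraph (Kpq p q) sigma).
Local Notation W := (neg_vertices Gam).

Definition on_left (x : V) : bool := if x is inl _ then true else false.

Definition part (b : bool) (x : V) := on_left x == b.

(** The indicators of [part true], [part false], [neg_part true] and [neg_part false] are the [u],
    [v], [a], [b] of [char_poly_rank2_update]. *)
Definition neg_part (b : bool) (x : V) := (on_left x == b) && (x \in W).

Lemma Kpq_adjE (x y : V) : Kpq_adj x y = (on_left x != on_left y).
Proof. by case: x => ?; case: y. Qed.

Lemma adj_mx_Kpq (R : comNzRingType) :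
  adj_mx R (Kpq p q) =
    ind_col R (part true) *m (ind_col R (part false))^T
    + ind_col R (part false) *m (ind_col R (part true))^T.
Proof.
apply/matrixP=> i j; rewrite !mxE !big_ord1 !mxE /= Kpq_adjE.
by rewrite /part; case: (on_left _); case: (on_left _) => /=; ring.
Qed.

Lemma card_part b : #|[set x | part b x]| = if b then p else q.
Proof.
case: b.
  rewrite -[RHS]card_ord -cardsT -(card_imset _ (@inl_inj 'I_p 'I_q)).
  apply: eq_card => -[x|x]; rewrite !inE /=; symmetry; last first.
    by apply/imsetP => -[].
  by apply/imsetP; exists x.
rewrite -[RHS]card_ord -cardsT -(card_imset _ (@inr_inj 'I_p 'I_q)).
apply: eq_card => -[x|x]; rewrite !inE /=; symmetry.
  by apply/imsetP => -[].
by apply/imsetP; exists x.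
Qed.

Lemma leq_card_neg_part b :
  (#|[set x | neg_part b x]| <= #|[set x | part b x]|)%N.
Proof. by apply: subset_leq_card; apply/subsetP=> x; rewrite !inE => /andP[]. Qed.

Hypothesis H_regular : regular r (neg_subgraph Gam).

(** Only the values of [P] on H matter, so a whole side and its trace on H have the same image: a
    vertex of H has its r negative neighbours on the other side. *)
Lemma neg_mx_part (R : comNzRingType) (b : bool) (P : pred V) :
  (forall x, x \in W -> P x = part b x) ->
  neg_mx R Gam *m ind_col R P = r%:R *: ind_col R (neg_part (~~ b)).
Proof.
move=> PW; apply/colP=> i; rewrite !mxE; set x := enum_val i.
under eq_bigr do rewrite !mxE -natrM mulnb.
rewrite (sum_enum_val (fun y => (neg_edge Gam x y && P y)%:R)) -natr_sum.
rewrite -big_mkcond sum1dep_card /= -natrM mulnC; congr (_%:R).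
transitivity ((on_left x == ~~ b) * #|[set y | neg_edge Gam x y]|)%N; last first.
  by rewrite (neg_degree _ H_regular) mulnA mulnb.
have nbr y : neg_edge Gam x y -> P y = (on_left x == ~~ b).
  move=> xy; rewrite PW; last first.
    by rewrite neg_edge_sym in xy; apply: neg_edge_vertices xy.
  move: xy; rewrite /neg_edge /= Kpq_adjE => /andP[+ _].
  by rewrite /part; case: (on_left x); case: (on_left y); case: (b).
case: (boolP (on_left x == ~~ b)) => xb.
  rewrite mul1n; apply: eq_card => y; rewrite !inE.
  by case E: neg_edge => //=; rewrite (nbr _ E) xb.
rewrite mul0n; apply/eqP; rewrite cards_eq0; apply/eqP/setP=> y; rewrite !inE.
by case E: neg_edge => //=; rewrite (nbr _ E) (negPf xb).
Qed.

Lemma neg_mx_ind_part (R : comNzRingType) b :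
  neg_mx R Gam *m ind_col R (part b) = r%:R *: ind_col R (neg_part (~~ b)).
Proof. exact: neg_mx_part. Qed.

Lemma neg_mx_ind_neg_part (R : comNzRingType) b :
  neg_mx R Gam *m ind_col R (neg_part b) = r%:R *: ind_col R (neg_part (~~ b)).
Proof. by apply: neg_mx_part => x xW; rewrite /neg_part xW andbT. Qed.

Lemma neg_mx_sym (R : comNzRingType) : (neg_mx R Gam)^T = neg_mx R Gam.
Proof. by apply/matrixP=> i j; rewrite !mxE neg_edge_sym. Qed.

Hypotheses (k_gt0 : (0 < k)%N) (H_order : #|W| = (2 * k)%N).

Lemma degree_gt0 : (0 < r)%N.
Proof.
have /card_gt0P [x xW] : (0 < #|W|)%N by rewrite H_order muln_gt0.
have := neg_degree x H_regular; rewrite xW mul1n => <-.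
move: xW; rewrite inE => /existsP [y xy].
by apply/card_gt0P; exists y; rewrite inE.
Qed.

(** Counting negative edges from either side gives r n(true) = r n(false) with r > 0. The count is
    the bilinear form of [neg_mx] on the two indicators; its symmetry exchanges the sides. *)
Lemma card_neg_part b : #|[set x | neg_part b x]| = k.
Proof.
pose n b := #|[set x | neg_part b x]|; rewrite -/(n b).
have nE c : (ind_col rat (neg_part c))^T *m ind_col rat (neg_part c) = (n c)%:R%:M.
  by rewrite ind_col_dot; congr (_%:R%:M); apply: eq_card => x; rewrite !inE andbb.
have dot c : (ind_col rat (neg_part c))^T *m (neg_mx rat Gam *m ind_col rat (neg_part (~~ c)))
    = (r * n c)%:R%:M.
  by rewrite neg_mx_ind_neg_part negbK -scalemxAr nE scale_scalar_mx natrM.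
have n_eq : n true = n false.
  have := congr1 trmx (dot true); rewrite !trmx_mul trmxK neg_mx_sym -mulmxA.
  rewrite (dot false) tr_scalar_mx => /matrixP/(_ 0 0); rewrite !mxE !mulr1n.
  by move/eqP; rewrite eqr_nat eqn_pmul2l ?degree_gt0 // => /eqP.
have : (n true + n false = 2 * k)%N.
  rewrite -H_order -(cardsID [set x : V | on_left x] W); congr (_ + _)%N.
    by apply: eq_card => x; rewrite !inE /neg_part !inE eqb_id andbC.
  by apply: eq_card => x; rewrite !inE /neg_part !inE eqbF_neg.
by rewrite n_eq addnn -mul2n => /eqP; rewrite eqn_pmul2l // => /eqP nk; case: b; rewrite ?n_eq.
Qed.

End NegativeEdgesOfKpq.

(** * Biquadratic polynomials and symmetric decreasing lists *)

(** The quadratic in X^2 has roots (S +- sqrt D) / 2. As [Pi] is nonnegative, sqrt D is at most [S],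
    so both are nonnegative and have genuine square roots. *)
Lemma biquadratic_factor (R : rcfType) (S Pi D lam1 lam2 : R) :
  0 <= S -> 0 <= Pi -> D = S ^+ 2 - 4 * Pi -> 0 <= D ->
  lam1 = Num.sqrt ((S + Num.sqrt D) / 2) ->
  lam2 = Num.sqrt ((S - Num.sqrt D) / 2) ->
  \prod_(x <- [:: lam1; - lam1; lam2; - lam2]) ('X - x%:P)
    = 'X^4 - S%:P * 'X^2 + Pi%:P.
Proof.
move=> S0 Pi0 DE D0 lam1E lam2E.
have sqrD : Num.sqrt D ^+ 2 = D by rewrite sqr_sqrtr.
have le_sqrD : Num.sqrt D <= S.
  by rewrite -(ler_pXn2r (_ : 0 < 2)%N) ?nnegrE ?sqrtr_ge0 // sqrD DE; lra.
have lam1_sqr : lam1 ^+ 2 = (S + Num.sqrt D) / 2.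
  by rewrite lam1E sqr_sqrtr // divr_ge0 // addr_ge0 // sqrtr_ge0.
have lam2_sqr : lam2 ^+ 2 = (S - Num.sqrt D) / 2.
  by rewrite lam2E sqr_sqrtr // divr_ge0 // subr_ge0.
have -> : S = lam1 ^+ 2 + lam2 ^+ 2 by rewrite lam1_sqr lam2_sqr; field.
have -> : Pi = lam1 ^+ 2 * lam2 ^+ 2.
  have -> : Pi = (S ^+ 2 - Num.sqrt D ^+ 2) / 4 by rewrite sqrD DE; field.
  by rewrite lam1_sqr lam2_sqr; field.
by rewrite !big_cons big_nil !rmorphN !rmorphD !rmorphM /=; ring.
Qed.

(** By the reversal symmetry the last [k] entries are the opposites of the first [k]; the index
    starts at 1 to match mu_i. *)
Lemma sorted_symmetric_perm (R : numDomainType) (s : seq R) (k : nat) :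
  s = rev [seq - x | x <- s] -> size s = (2 * k)%N ->
  perm_eq s ([seq s`_(i.-1) | i <- index_iota 1 k.+1]
             ++ [seq - s`_(i.-1) | i <- index_iota 1 k.+1]).
Proof.
move=> s_rev size_s.
have -> : [seq s`_(i.-1) | i <- index_iota 1 k.+1] = take k s.
  rewrite /index_iota subn1 /= -[1%N]addn0 iotaDl -map_comp /=.
  by rewrite (map_nth_iota0 0) // size_s; lia.
have -> : [seq - s`_(i.-1) | i <- index_iota 1 k.+1] = [seq - x | x <- take k s].
  rewrite /index_iota subn1 /= -[1%N]addn0 iotaDl -map_comp /=.
  by rewrite -(map_nth_iota0 0) ?size_s; [rewrite -map_comp | lia].
rewrite -{1}(cat_take_drop k s) perm_cat2l {1}s_rev drop_rev size_map size_s.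
have -> : (2 * k - k = k)%N by lia.
by rewrite -map_take perm_rev.
Qed.

(** The two middle entries are opposite, and the first is the larger. *)
Lemma sorted_symmetric_ge0 (R : realDomainType) (s : seq R) (k : nat) :
  sorted >=%R s -> s = rev [seq - x | x <- s] -> size s = (2 * k)%N ->
  (0 < k)%N -> 0 <= s`_(k.-1).
Proof.
move=> s_sorted s_rev size_s k_gt0.
have sk : s`_(k.-1) = - s`_k.
  rewrite {1}s_rev nth_rev size_map size_s; last by lia.
  rewrite (nth_map 0) ?size_s; last by lia.
  by congr (- s`_ _); lia.
have : s`_k <= s`_(k.-1).
  by apply: (sorted_leq_nth ge_trans ge_refl) => //; rewrite ?inE ?size_s; lia.
by rewrite sk; lra.
Qed.

(** * The characteristic polynomial and spectrum of signed K_{p,q} *)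

Section SignedKpq.
Variables (R : rcfType) (p q r k : nat) (sigma : {set ('I_p + 'I_q)%type} -> bool).

Local Notation V := ('I_p + 'I_q)%type.
Local Notation Gam := (SignedGraph (Kpq p q) sigma).
Local Notation W := (neg_vertices Gam).

Hypotheses (k_gt0 : (0 < k)%N) (H_order : #|W| = (2 * k)%N)
  (H_regular : regular r (neg_subgraph Gam)).

Lemma signed_Kpq_char_poly :
  let c : R := - 2 * r%:R in
  char_poly (signed_adj_mx R Gam) * ('X^2 * ('X^2 - (c ^+ 2)%:P)) =
  char_poly ((- 2) *: neg_mx R Gam) *
    ('X^4 - (p%:R * q%:R + c ^+ 2 + 2 * c * k%:R)%:P * 'X^2
     + (c ^+ 2 * (p%:R - k%:R) * (q%:R - k%:R))%:P).
Proof.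
move=> c.
have part2 b b' : #|[set x : V | part b x && part b' x]| =
    (if b == b' then if b then p else q else 0)%N.
  case: eqP => [->|bb'].
    by rewrite -(card_part p q); apply: eq_card => x; rewrite !inE andbb.
  apply/eqP; rewrite cards_eq0; apply/eqP/setP=> x; rewrite !inE /part.
  by case: (on_left x) bb'; case: b; case: b'.
have part_neg b b' : #|[set x : V | part b x && neg_part sigma b' x]| =
    (if b == b' then k else 0)%N.
  case: eqP => [->|bb'].
    rewrite -(card_neg_part H_regular k_gt0 H_order b').
    by apply: eq_card => x; rewrite !inE /neg_part /part andbA andbb.
  apply/eqP; rewrite cards_eq0; apply/eqP/setP=> x; rewrite !inE /part /neg_part.
  by case: (on_left x) bb'; case: b; case: b'.
rewrite signed_adj_mxE adj_mx_Kpq addrC addrA -scaleNr.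
have NP b : - 2 *: neg_mx R Gam *m ind_col R (part b)
    = c *: ind_col R (neg_part sigma (~~ b)).
  by rewrite -scalemxAl (neg_mx_ind_part H_regular) scalerA.
have NNP b : - 2 *: neg_mx R Gam *m ind_col R (neg_part sigma b)
    = c *: ind_col R (neg_part sigma (~~ b)).
  by rewrite -scalemxAl (neg_mx_ind_neg_part H_regular) scalerA.
apply: (char_poly_rank2_update (NP true) (NNP true) (NP false) (NNP false)).
all: rewrite ind_col_dot ?(part2 true) ?(part2 false) ?part_neg //=.
all: by rewrite raddf0.
Qed.

Lemma k_leq b : (k <= if b then p else q)%N.
Proof.
by rewrite -(card_part p q b) -(card_neg_part H_regular k_gt0 H_order b) leq_card_neg_part.
Qed.

Variable hs : seq R.
Hypotheses (hs_spectrum : is_spectrum (adj_mx R (neg_subgraph Gam)) hs)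
  (hs_sorted : sorted >=%R hs).

Lemma size_hs : size hs = (2 * k)%N.
Proof.
apply: succn_inj; rewrite -(size_prod_XsubC _ id) -hs_spectrum size_char_poly.
by rewrite card_sig H_order.
Qed.

Lemma hs_rev : hs = rev [seq - x | x <- hs].
Proof.
apply: sorted_opp_rev => //.
apply: (bipartite_spectrum_opp (side := fun x => on_left (val x))) hs_spectrum.
by move=> x y /andP[/= + _]; rewrite Kpq_adjE.
Qed.

Lemma hs_head : hs`_0 = r%:R.
Proof.
apply: regular_spectrum_head H_regular hs_spectrum hs_sorted.
by rewrite card_sig H_order muln_gt0.
Qed.

(** The index i = 1, where mu_1 = r, yields the roots 2r and -2r; their factor is split off to
    cancel the one in [signed_Kpq_char_poly]. *)
Lemma char_poly_neg_mx_Kpq :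
  char_poly ((- 2) *: neg_mx R Gam) * 'X^(2 * k) =
  ('X^2 - ((- 2 * r%:R) ^+ 2)%:P) *
  \prod_(x <- [seq 2 * hs`_(i.-1) | i <- index_iota 2 k.+1]
             ++ [seq - (2 * hs`_(i.-1)) | i <- index_iota 2 k.+1]) ('X - x%:P)
  * 'X^(p + q).
Proof.
have := char_poly_neg_mx Gam (- 2 : R).
have cardV : #|{: V}| = (p + q)%N by rewrite card_sum !card_ord.
rewrite H_order => ->; congr (_ * 'X^_) => //.
have N2 : (- 2 : R) != 0 by rewrite oppr_eq0 pnatr_eq0.
rewrite (char_poly_scale N2 hs_spectrum) big_map.
rewrite (perm_big _ (sorted_symmetric_perm hs_rev size_hs)) /=.
rewrite !big_cat !big_map /= big_ltn //.
rewrite [X in _ * X]big_ltn //=.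
set h := nth _ hs 0; have -> : h = r%:R := hs_head.
rewrite mulrACA; congr (_ * _).
  by rewrite !rmorphM !rmorphN /=; ring.
(* Scaling by -2 sends mu_i to -2 mu_i and -mu_i to 2 mu_i, so the two halves arrive in swapped
   order. *)
rewrite mulrC; congr (_ * _); apply: eq_bigr => i _.
  by congr (_ - _%:P); ring.
by congr (_ - _%:P); ring.
Qed.

End SignedKpq.

(* [hs] lists the eigenvalues of H in decreasing order, so that mu_i is
   [hs`_(i.-1)] (mu_1 is [hs`_0]).  The list [others] consists of the
   p + q - 2(k-1) eigenvalues left once +-2mu_2, ..., +-2mu_k are removed.
   When 2k + 2 <= p + q, the first [nseq] is empty: the others are the four
   displayed values and p + q - 2k - 2 zeros.  If p = k and q is k or k + 1,
   fewer than four eigenvalues are left, and (2k + 2) - (p + q) of the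
   displayed values, all equal to 0, are superfluous. *)
Theorem theorem5p2 (R : rcfType) (p q r k : nat)
    (sigma : {set ('I_p + 'I_q)%type} -> bool) (hs : seq R)
    (le_pq : (p <= q)%N) (k_gt0 : (0 < k)%N)
    (H_regular : regular r (neg_subgraph (SignedGraph (Kpq p q) sigma)))
    (H_order : #|neg_vertices (SignedGraph (Kpq p q) sigma)| = (2 * k)%N)
    (hs_spectrum :
      is_spectrum (adj_mx R (neg_subgraph (SignedGraph (Kpq p q) sigma))) hs)
    (hs_sorted : sorted >=%R hs) :
  let A := signed_adj_mx R (SignedGraph (Kpq p q) sigma) in
  let mu (i : nat) : R := hs`_(i.-1) in
  let P : R := p%:R in let Q : R := q%:R in
  let K : R := k%:R in let r' : R := r%:R in
  let S : R := P * Q + (K - 2 * r') ^+ 2 - K ^+ 2 in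
  let D : R := S ^+ 2
    - 4 * ((K - 2 * r') ^+ 2 + K * (Q - K) - K * (Q - 2 * r') ^+ 2 / Q)
        * (Q * (P - K)) in
  let lam1 : R := Num.sqrt ((S + Num.sqrt D) / 2) in
  let lam2 : R := Num.sqrt ((S - Num.sqrt D) / 2) in
  (p + q <= mup 0 (char_poly A) + (2 * k + 2))%N
  /\
  [/\ mu 1%N = r' /\ 0 <= mu k,
      forall i : nat, (2 <= i <= k)%N ->
        eigenvalue A (2 * mu i) /\ eigenvalue A (- (2 * mu i))
    & exists2 others : seq R,
        is_spectrum A
          ([seq 2 * mu i | i <- index_iota 2 k.+1]
             ++ [seq - (2 * mu i) | i <- index_iota 2 k.+1] ++ others)
      & perm_eq (others ++ nseq ((2 * k + 2) - (p + q)) 0)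
          ([:: lam1; - lam1; lam2; - lam2]
             ++ nseq ((p + q) - (2 * k + 2)) 0)].
Proof.
move=> A mu P Q K r' S D lam1 lam2.
have hsR := hs_rev hs_spectrum hs_sorted.
have szhs := size_hs H_order hs_spectrum.
have mu1 : mu 1%N = r' := hs_head k_gt0 H_order H_regular hs_spectrum hs_sorted.
have muk : 0 <= mu k := sorted_symmetric_ge0 hs_sorted hsR szhs k_gt0.
have le_kp : (k <= p)%N := k_leq k_gt0 H_order H_regular true.
have le_kq : (k <= q)%N := k_leq k_gt0 H_order H_regular false.
have [KP KQ K0] : [/\ K <= P, K <= Q & 0 < K] by rewrite !ler_nat ltr0n.
pose c := - 2 * r'.
pose Pi := c ^+ 2 * (P - K) * (Q - K).
have SE : S = P * Q + c ^+ 2 + 2 * c * K by rewrite /S /c; ring.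
have Pi0 : 0 <= Pi by apply: mulr_ge0; [apply: mulr_ge0|]; rewrite ?sqr_ge0 ?subr_ge0.
(* The displayed bracket times [Q] collapses to 4 r'^2 (Q - K). *)
have DE : D = S ^+ 2 - 4 * Pi.
  by rewrite /D /Pi /c; field; rewrite gt_eqF //; lra.
have S0 : 0 <= S.
  have : K * K <= P * Q by apply: ler_pM => //; lra.
  by have := sqr_ge0 (K - 2 * r'); rewrite /S expr2 (expr2 K); lra.
(* [(x - y)^2 + 4 z] is the discriminant of the characteristic polynomial of a
   2 x 2 matrix with diagonal [x, y] and product [z] of the other entries: here
   the quotient matrix of [B *m B^T], for [B] the bipartite block of [A]. *)
have D0 : 0 <= D.
  have -> : D = (Q * (P - K) - ((K - 2 * r') ^+ 2 + K * (Q - K))) ^+ 2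
      + 4 * ((Q - 2 * r') ^+ 2 * (K * (P - K))).
    by rewrite /D /S; field; rewrite gt_eqF //; lra.
  rewrite addr_ge0 ?sqr_ge0 // mulr_ge0 // mulr_ge0 ?sqr_ge0 //.
  by rewrite mulr_ge0 //; lra.
have quad := biquadratic_factor S0 Pi0 DE D0 (erefl lam1) (erefl lam2).
set m := [seq 2 * mu i | i <- index_iota 2 k.+1].
set m' := [seq - (2 * mu i) | i <- index_iota 2 k.+1].
(* Powers of X stay on both sides because p + q may be smaller than 2k + 2. *)
have charA : char_poly A * 'X^(2 * k + 2) =
    'X^(p + q) * \prod_(x <- m ++ m' ++ [:: lam1; - lam1; lam2; - lam2]) ('X - x%:P).
  have E0 : ('X^2 - (c ^+ 2)%:P : {poly R}) != 0.
    by rewrite monic_neq0 // monicXnsubC.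
  pose N := neg_mx R (SignedGraph (Kpq p q) sigma).
  have AE : char_poly A * ('X^2 * ('X^2 - (c ^+ 2)%:P)) =
      char_poly (- 2 *: N) * ('X^4 - S%:P * 'X^2 + Pi%:P).
    by rewrite SE; apply: signed_Kpq_char_poly.
  have NE : char_poly (- 2 *: N) * 'X^(2 * k) = ('X^2 - (c ^+ 2)%:P) *
      \prod_(x <- m ++ m') ('X - x%:P) * 'X^(p + q).
    exact: char_poly_neg_mx_Kpq hs_spectrum hs_sorted.
  apply: (mulIf E0).
  transitivity (char_poly (- 2 *: N) * 'X^(2 * k) * ('X^4 - S%:P * 'X^2 + Pi%:P)).
    by rewrite [RHS]mulrAC -AE exprD; move: 'X^(2 * k) => Y; ring.
  by rewrite NE !big_cat /= quad; move: 'X^(p + q) => Y; ring.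
have prod_nseq0 n : \prod_(x <- nseq n (0 : R)) ('X - x%:P) = 'X^n.
  by elim: n => [|n IHn]; rewrite ?big_nil // big_cons IHn subr0 exprS.
have Xn0 n : ('X^n : {poly R}) != 0 by rewrite monic_neq0 ?monicXn.
have charA_lead : (2 * k + 2 <= p + q)%N -> char_poly A =
    'X^(p + q - (2 * k + 2)) *
      \prod_(x <- m ++ m' ++ [:: lam1; - lam1; lam2; - lam2]) ('X - x%:P).
  move=> le_k; apply: (mulIf (Xn0 (2 * k + 2)%N)).
  by rewrite charA mulrAC -exprD subnK.
have [others oA oE] : exists2 others : seq R, is_spectrum A (m ++ m' ++ others)
      & perm_eq (others ++ nseq ((2 * k + 2) - (p + q)) 0)
          ([:: lam1; - lam1; lam2; - lam2] ++ nseq ((p + q) - (2 * k + 2)) 0).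
  case: (leqP (2 * k + 2) (p + q)) => [le_k | lt_k].
    exists ([:: lam1; - lam1; lam2; - lam2] ++ nseq ((p + q) - (2 * k + 2)) 0).
      by rewrite /is_spectrum (charA_lead le_k) !catA [RHS]big_cat prod_nseq0 mulrC.
    have -> : ((2 * k + 2) - (p + q) = 0)%N by lia.
    by rewrite cats0.
  (* Here p + q is 2k or 2k + 1, which forces p = k. Then [Pi] is 0, [D] is S^2 and [lam2] vanishes;
     beside [lam1] and its opposite, p + q - 2k zeros remain. *)
  have p_k : p = k by lia.
  have Pi_eq0 : Pi = 0 by rewrite /Pi /P p_k subrr mulr0 mul0r.
  have lam2_0 : lam2 = 0.
    by rewrite /lam2 DE Pi_eq0 mulr0 subr0 sqrtr_sqr ger0_norm // subrr mul0r sqrtr0.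
  exists ([:: lam1; - lam1] ++ nseq (p + q - 2 * k) 0).
    apply: (mulIf (Xn0 (2 * k + 2)%N)); rewrite charA lam2_0 oppr0.
    rewrite !big_cat /= prod_nseq0 !big_cons !big_nil subr0.
    have -> : (p + q = (p + q - 2 * k) + 2 * k)%N by lia.
    by rewrite addnK [in LHS]exprD [in RHS]exprD; move: 'X^(2 * k) 'X^(_ - _) => X1 X2; ring.
  rewrite -catA -nseqD lam2_0 oppr0.
  have -> : (p + q - 2 * k + (2 * k + 2 - (p + q)) = 2)%N by lia.
  by have -> : (p + q - (2 * k + 2) = 0)%N by lia.
split; first last.
  split=> //; last by exists others.
  move=> i ik; rewrite !eigenvalue_root_char oA !root_prod_XsubC !mem_cat.
  have im : i \in index_iota 2 k.+1 by rewrite mem_index_iota ltnS.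
  by rewrite (map_f (fun j => 2 * mu j) im) (map_f (fun j => - (2 * mu j)) im) orbT.
(* The multiplicity bound becomes divisibility by a power of X, whose truncated exponent is 0 when p
   + q < 2k + 2. *)
rewrite [leqRHS]addnC -leq_subLR mup_geq ?monic_neq0 ?char_poly_monic // subr0.
case: (leqP (2 * k + 2) (p + q)) => [/charA_lead -> | lt_k].
  by rewrite dvdp_mulr.
have -> : (p + q - (2 * k + 2) = 0)%N by lia.
by rewrite expr0 dvd1p.
Qed.
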